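(* Let $\Omega\subseteq\mathbb{H}$ be a non-empty circular domain and let $f=f_0+f_v\in\mathcal{SR}(\Omega)$. Then $$\exp_*(f)=\exp_*(f_0)\left(\sum_{m\in\mathbb{N}}\frac{(-1)^m(f_v^s)^m}{(2m)!}+\sum_{m\in\mathbb{N}}\frac{(-1)^m(f_v^s)^m}{(2m+1)!}\,f_v\right).$$
   Context: $\mathbb{H}$ is the algebra of quaternions (with the Euclidean topology of $\mathbb{R}^4$), with conjugation $q\mapsto q^c$, and $\mathbb{S}=\{q\in\mathbb{H}: q^2=-1\}$. For $D\subseteq\mathbb{C}=\{\alpha+\imath\beta:\alpha,\beta\in\mathbb{R}\}$ invariant under complex conjugation, $\Omega_D=\{\alpha+\beta I:\alpha+\imath\beta\in D,\ I\in\mathbb{S}\}$; sets of this form are called circular, and a circular domain is a connected open circular subset of $\mathbb{H}$. A stem function is $F=F_1+\imath F_2:D\to\mathbb{H}\otimes_{\mathbb{R}}\mathbb{C}$ ($F_1,F_2$ $\mathbb{H}$-valued) with $F(\overline z)=\overline{F(z)}$, where $\overline{p+\imath q}=p-\imath q$. It induces the slice function $f=\mathcal{I}(F):\Omega_D\to\mathbb{H}$, $f(\alpha+\beta I)=F_1(\alpha+\imath\beta)+I F_2(\alpha+\imath\beta)$. On a circular domain $\Omega=\Omega_D$, $f=\mathcal I(F)$ is slice-regular if $F$ is holomorphic for the natural complex structures of $\mathbb{C}$ and $\mathbb{H}\otimes_{\mathbb{R}}\mathbb{C}$; $\mathcal{SR}(\Omega)$ is the set of slice-regular functions, and $f$ is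 slice-preserving if $F_1,F_2$ are real-valued. The $*$-product is $\mathcal I(F)*\mathcal I(G)=\mathcal I(FG)$, with $(p+\imath q)(p'+\imath q')=pp'-qq'+\imath(pq'+qp')$; if one factor is slice-preserving it is the pointwise product. For $f=\mathcal I(F_1+\imath F_2)\in\mathcal{SR}(\Omega)$: $f^c=\mathcal I(F_1^c+\imath F_2^c)$, $f_0=\frac{f+f^c}{2}$, $f_v=\frac{f-f^c}{2}$ (so $f=f_0+f_v$), $f^s=f*f^c$, and $f_v^s$ means $(f_v)^s$; the functions $f_0$ and $f_v^s$ are slice-preserving. The $*$-exponential is $\exp_*(f)=\sum_{n\in\mathbb{N}}\frac{f^{*n}}{n!}$ ($f^{*n}$ the $n$-th $*$-power, $f^{*0}=1$), which converges uniformly on compact subsets of $\Omega$ to an element of $\mathcal{SR}(\Omega)$. Products and powers in the formula are pointwise. *)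

(* Defs.v *)
From HB Require Import structures.
From mathcomp Require Import all_boot all_order all_algebra.
From mathcomp Require Import all_classical all_reals all_analysis.
From mathcomp Require Import ring lra.

Set Implicit Arguments.
Unset Strict Implicit.
Unset Printing Implicit Defensive.

Import Order.TTheory GRing.Theory Num.Theory numFieldNormedType.Exports.

Local Open Scope classical_set_scope.
Local Open Scope ring_scope.

(* The complex plane in the coordinates (alpha, beta) of alpha + i beta, as a
   real normed space.  It is not given its field structure, so the product of
   R * R must never be used. *)
Definition Cplane (R : realType) : Type := (R * R)%type.

HB.instance Definition _ (R : realType) := NormedModule.on (Cplane R).

Definition cconj (R : realType) (z : Cplane R) : Cplane R := (z.1, - z.2).

Definition cmuli (R : realType) (z : Cplane R) : Cplane R := (- z.2, z.1).

(* The quaternion a + b i + c j + d k is encoded as (a, b, c, d); the norm is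
   the sup norm, which induces the Euclidean topology of R^4. *)
Definition quat (R : realType) : Type := (R * R * R * R)%type.

HB.instance Definition _ (R : realType) := NormedModule.on (quat R).

Section QuaternionAlgebra.
Variable R : realType.
Implicit Types p q : quat R.

Definition qone : quat R := (1, 0, 0, 0).

Definition qmul p q : quat R :=
  let: (a, b, c, d) := p in
  let: (a', b', c', d') := q in
  (a * a' - b * b' - c * c' - d * d',
   a * b' + b * a' + c * d' - d * c',
   a * c' - b * d' + c * a' + d * b',
   a * d' + b * c' - c * b' + d * a').

Definition qconj q : quat R :=
  let: (a, b, c, d) := q in (a, - b, - c, - d).

Fact qmulA : associative qmul.
Proof.
move=> [[[a b] c] d] [[[a' b'] c'] d'] [[[x y] z] t] /=.
by congr (_, _, _, _); ring.
Qed.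

Fact qmul1q : left_id qone qmul.
Proof. by move=> [[[a b] c] d] /=; congr (_, _, _, _); ring. Qed.

Fact qmulq1 : right_id qone qmul.
Proof. by move=> [[[a b] c] d] /=; congr (_, _, _, _); ring. Qed.

Fact qmulDl : left_distributive qmul +%R.
Proof.
move=> [[[a b] c] d] [[[a' b'] c'] d'] [[[x y] z] t].
by congr (_, _, _, _) => /=; ring.
Qed.

Fact qmulDr : right_distributive qmul +%R.
Proof.
move=> [[[a b] c] d] [[[a' b'] c'] d'] [[[x y] z] t].
by congr (_, _, _, _) => /=; ring.
Qed.

Fact qone_neq0 : qone != 0.
Proof. by apply/eqP => -[] /eqP; rewrite oner_eq0. Qed.

HB.instance Definition _ := GRing.Zmodule_isNzRing.Build (quat R)
  qmulA qmul1q qmulq1 qmulDl qmulDr qone_neq0.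

Fact qscalerAl (k : R) p q : k *: qmul p q = qmul (k *: p) q.
Proof.
case: p q => [[[a b] c] d] [[[a' b'] c'] d'].
by rewrite /GRing.scale /=; congr (_, _, _, _); rewrite /GRing.scale /=; ring.
Qed.

HB.instance Definition _ :=
  GRing.Lmodule_isLalgebra.Build R (quat R) qscalerAl.

Fact qscalerAr (k : R) p q : k *: qmul p q = qmul p (k *: q).
Proof.
case: p q => [[[a b] c] d] [[[a' b'] c'] d'].
by rewrite /GRing.scale /=; congr (_, _, _, _); rewrite /GRing.scale /=; ring.
Qed.

HB.instance Definition _ :=
  GRing.Lalgebra_isAlgebra.Build R (quat R) qscalerAr.

End QuaternionAlgebra.

(* H (x)_R C; the pair (p, q) encodes p + i q.  Its product is hcmul. *)
Definition hc (R : realType) : Type := (quat R * quat R)%type.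

HB.instance Definition _ (R : realType) := NormedModule.on (hc R).

Section Complexification.
Variable R : realType.
Implicit Types x y : hc R.

Definition hcmul x y : hc R :=
  (x.1 * y.1 - x.2 * y.2, x.1 * y.2 + x.2 * y.1).

Definition hcbar x : hc R := (x.1, - x.2).

Definition hcconj x : hc R := (qconj x.1, qconj x.2).

Definition hcmuli x : hc R := (- x.2, x.1).

End Complexification.

Section SliceFunctions.
Variable R : realType.
Implicit Types (D : set (Cplane R)) (F G : Cplane R -> hc R).
Implicit Types (f g : quat R -> quat R) (q I : quat R) (z : Cplane R).

Definition imag_units : set (quat R) := [set I | I ^+ 2 = - 1].

Definition conj_invariant D := forall z, D z -> D (cconj z).

(* Omega_D *)
Definition circularization D : set (quat R) :=
  [set q | exists z I, [/\ D z, imag_units I & q = z.1%:A + z.2 *: I]].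

Definition stem_function D F := forall z, D z -> F (cconj z) = hcbar (F z).

(* f = I(F) on Omega_D *)
Definition induces D F f := forall z I, D z -> imag_units I ->
  f (z.1%:A + z.2 *: I) = (F z).1 + I * (F z).2.

(* Complex differentiability: real Frechet differentiability with a
   differential that commutes with the complex structures. *)
Definition holomorphic_on D F := forall z, D z ->
  differentiable F z /\ forall h, 'd F z (cmuli h) = hcmuli ('d F z h).

Definition slice_regular D f :=
  exists F, [/\ stem_function D F, holomorphic_on D F & induces D F f].

Definition qre q : R := q.1.1.1.

Definition qim q : quat R := q - (qre q)%:A.

(* The Euclidean modulus, which is not the norm `|q|. *)
Definition qabs q : R :=
  let: (a, b, c, d) := q in Num.sqrt (a ^+ 2 + b ^+ 2 + c ^+ 2 + d ^+ 2).

(* I(F), computed from the decomposition q = alpha + beta I with beta >= 0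
   (see slice_induces).  For real q the second summand vanishes, as 0^-1 = 0. *)
Definition slice F q : quat R :=
  let z : Cplane R := (qre q, qabs (qim q)) in
  (F z).1 + ((qabs (qim q))^-1 *: qim q) * (F z).2.

(* The stem function of f, which is unique on D (see induces_inj). *)
Definition stem D f : Cplane R -> hc R :=
  xget (fun=> 0) [set F | stem_function D F /\ induces D F f].

Definition star D f g : quat R -> quat R :=
  slice (fun z => hcmul (stem D f z) (stem D g z)).

Definition star_pow D f n : quat R -> quat R := iter n (star D f) (fun=> 1).

Definition slice_conj D f : quat R -> quat R :=
  slice (fun z => hcconj (stem D f z)).

Definition slice_norm D f : quat R -> quat R := star D f (slice_conj D f).

Definition slice_re D f : quat R -> quat R :=
  fun q => 2^-1 *: (f q + slice_conj D f q).

Definition slice_vec D f : quat R -> quat R :=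
  fun q => 2^-1 *: (f q - slice_conj D f q).

Definition exp_star_series D f q : (quat R)^nat :=
  [series (n`!%:R^-1 : R) *: star_pow D f n q]_n.

Definition exp_star D f q : quat R := limn (exp_star_series D f q).

(* sum_m (-1)^m x^m / (2m)! and sum_m (-1)^m x^m / (2m+1)! *)
Definition cos_sqrt_series (x : quat R) : (quat R)^nat :=
  [series ((-1) ^+ m / (2 * m)`!%:R : R) *: x ^+ m]_m.

Definition sinc_sqrt_series (x : quat R) : (quat R)^nat :=
  [series ((-1) ^+ m / (2 * m).+1`!%:R : R) *: x ^+ m]_m.

Lemma imag_unitsE I : imag_units I ->
  qre I = 0 /\ I.1.1.2 ^+ 2 + I.1.2 ^+ 2 + I.2 ^+ 2 = 1.
Proof.
case: I => [[[a b] c] d]; rewrite /imag_units /= expr2 /qre /= => -[h1 h2 h3 h4].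
have hab : a * b = 0 by lra.
have hac : a * c = 0 by lra.
have had : a * d = 0 by lra.
suff a0 : a = 0 by split=> //; rewrite a0 in h1; lra.
apply/eqP/negPn/negP => a0.
have z0 y : a * y = 0 -> y = 0.
  by move/eqP; rewrite mulf_eq0 (negPf a0) /= => /eqP.
move: h1; rewrite (z0 _ hab) (z0 _ hac) (z0 _ had) => h1.
by have := sqr_ge0 a; rewrite expr2; lra.
Qed.

Lemma induces_inj D F G f :
  induces D F f -> induces D G f -> forall z, D z -> F z = G z.
Proof.
move=> hF hG z Dz; pose I : quat R := (0, 1, 0, 0).
have I2 : I * I = -1 by congr (_, _, _, _) => /=; ring.
have hI : imag_units I by rewrite /imag_units /= expr2.
have hN : imag_units (- I) by rewrite /imag_units /= sqrrN.
have h1 : (F z).1 + I * (F z).2 = (G z).1 + I * (G z).2.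
  by rewrite -hF // -hG.
have h2 : (F z).1 - I * (F z).2 = (G z).1 - I * (G z).2.
  by rewrite -!mulNr -hF // -hG.
have e1 : (F z).1 = (G z).1.
  have : 2 *: (F z).1 = 2 *: (G z).1 :> quat R.
    rewrite !scaler_nat !mulr2n.
    have := congr2 +%R h1 h2.
    by rewrite addrACA subrr addr0 addrACA subrr addr0.
  by move/scalerI; apply; rewrite pnatr_eq0.
have e2 : (F z).2 = (G z).2.
  move: h1; rewrite e1 => /addrI /(congr1 ( *%R I)).
  by rewrite !mulrA I2 !mulN1r => /oppr_inj.
by rewrite [LHS]surjective_pairing [RHS]surjective_pairing e1 e2.
Qed.

Lemma slice_induces D F :
  conj_invariant D -> stem_function D F -> induces D F (slice F).
Proof.
move=> hD hF [x y] I Dz hI; have [re0 nI] := imag_unitsE hI.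
set q := _ + _.
have qreE : qre q = x.
  by move: re0; rewrite /qre /q /= => ->; rewrite /GRing.scale /= mulr1 mulr0 addr0.
have qimE : qim q = y *: I by rewrite /qim qreE /q /= addrC addKr.
have qabsE : qabs (qim q) = `|y|.
  rewrite qimE; move: re0 nI; case: (I) => [[[a b] c] d].
  rewrite /qre /= => -> nI; rewrite /GRing.scale /= -sqrtr_sqr; congr Num.sqrt.
  by rewrite -[RHS]mulr1 -nI; ring.
rewrite /slice qreE qabsE qimE /=.
have [y0|y0|y0] := ltgtP y 0.
- have := hF _ Dz; rewrite /cconj /= ltr0_norm // => ->.
  rewrite /hcbar /= scalerA invrN mulNr mulVf ?lt_eqF //.
  by rewrite scaleN1r mulrNN.
- by rewrite gtr0_norm // scalerA mulVf ?gt_eqF // scale1r.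
- have := hF _ Dz; rewrite /cconj /= y0 oppr0 normr0 => /(congr1 snd) /= h.
  have -> : (F (x, 0)).2 = 0.
    apply/(@scalerI _ _ (2 : R)); first by rewrite pnatr_eq0.
    by rewrite scaler0 scaler_nat mulr2n {1}h addNr.
  by rewrite !mulr0.
Qed.

End SliceFunctions.

(* Main.v *)
Require Import Defs.
From HB Require Import structures.
From mathcomp Require Import all_boot all_order all_algebra.
From mathcomp Require Import all_classical all_reals all_analysis.
From mathcomp Require Import ring lra.

Set Implicit Arguments.
Unset Strict Implicit.
Unset Printing Implicit Defensive.

Import Order.TTheory GRing.Theory Num.Theory numFieldNormedType.Exports.

Local Open Scope classical_set_scope.
Local Open Scope ring_scope.

(** The identity is a pointwise statement about one element of the algebra
    A = H (x) C.  Fix z in D and a unit I, let q = alpha + beta I be the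
    corresponding point, and let x = F(z), where F is the stem function of f.
    The star product of slice functions is the product of their stem
    functions, so the n-th star power of f takes at q the value e_I(x ^ n),
    where e_I(a + i b) = a + I b is [slice_eval].  As e_I is linear and
    continuous, exp_*(f)(q) = e_I(exp x), the exponential being that of the
    finite-dimensional, hence complete, real algebra A
    ([exp_star_series_cvg]).

    In A write x = x0 + xv, where x0 and xv are the parts fixed and negated by
    the conjugation [hcconj] that f^c comes from.  The fixed elements have real
    components, so they form a copy of C in the centre of A
    ([hcconj_fixed_comm]).  Hence x0 and xv commute and
    exp x = exp x0 * exp xv ([hcexpD]).  The norm of xv is
    s = xv * xv^c = - xv ^ 2, so the terms of even and of odd order of exp xv
    add up to sum_m (-1)^m s^m / (2m)! and to
    (sum_m (-1)^m s^m / (2m+1)!) * xv ([hcexp_even_odd]).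

    It remains to apply e_I.  It is not multiplicative on A, but
    e_I(c y) = e_I(c) e_I(y) as soon as c is fixed by the conjugation
    ([slice_evalM]): then the components of c are real and commute with I.
    The elements exp x0, s and both sums in s are fixed, which is all that the
    formula requires. *)

(** * Completeness of H and of its complexification *)

Section ProductComplete.
Variables (U V : completeType).

HB.instance Definition _ := Pointed.on (U * V)%type.

(** Both projections of a Cauchy filter on a product are Cauchy filters. *)
Lemma pair_complete (F : set_system (U * V)) :
  ProperFilter F -> cauchy F -> cvg F.
Proof.
move=> FF Fc.
have c1 : cauchy (fst @ F).
  move=> A entA.
  have [] := Fc [set xy | A (xy.1.1, xy.2.1)].
    exists (A, setT); first by split => //=; exact: entourageT.
    by move=> [[a b] [c d]] [/= ? ?]; exists ((a, c), (b, d)).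
  move=> [X Y] /= [FX FY] XY; exists (fst @` X, fst @` Y).
    by split=> /=; [apply: filterS FX|apply: filterS FY] => x Xx; exists x.
  by move=> [a b] /= [[x Xx <-] [y Yy <-]]; exact: (XY (x, y)).
have c2 : cauchy (snd @ F).
  move=> A entA.
  have [] := Fc [set xy | A (xy.1.2, xy.2.2)].
    exists (setT, A); first by split => //=; exact: entourageT.
    by move=> [[a b] [c d]] [/= ? ?]; exists ((a, c), (b, d)).
  move=> [X Y] /= [FX FY] XY; exists (snd @` X, snd @` Y).
    by split=> /=; [apply: filterS FX|apply: filterS FY] => x Xx; exists x.
  by move=> [a b] /= [[x Xx <-] [y Yy <-]]; exact: (XY (x, y)).
move/cauchy_cvg : c1 => cvg1; move/cauchy_cvg : c2 => cvg2.
apply/cvg_ex; exists (lim (fst @ F), lim (snd @ F)).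
apply: cvg_trans (cvg_pair cvg1 cvg2) => A; rewrite !near_simpl /= => FA.
by apply: filterS FA => -[].
Qed.

HB.instance Definition _ := Uniform_isComplete.Build (U * V)%type
  pair_complete.

End ProductComplete.

HB.instance Definition _ (R : realType) := Complete.on (quat R).
HB.instance Definition _ (R : realType) := Complete.on (hc R).

(** * The algebra H (x) C *)

Section ComplexifiedQuaternions.
Variable R : realType.
Implicit Types x y : hc R.

Lemma hcmulA : associative (@hcmul R).
Proof.
move=> [a b] [c d] [e f]; rewrite /hcmul /=.
rewrite !mulrBl !mulrBr !mulrDl !mulrDr !mulrA; congr pair.
  by rewrite !opprD -!addrA; congr (_ + _); rewrite addrA addrC.
by rewrite -!addrA; congr (_ + _); rewrite addrA addrC.
Qed.

Lemma hcmul1x : left_id (1, 0) (@hcmul R).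
Proof. by move=> [a b]; rewrite /hcmul /= !mul1r !mul0r subr0 addr0. Qed.

Lemma hcmulx1 : right_id (1, 0) (@hcmul R).
Proof. by move=> [a b]; rewrite /hcmul /= !mulr1 !mulr0 subr0 add0r. Qed.

Lemma hcmulDl : left_distributive (@hcmul R) +%R.
Proof.
move=> [a b] [c d] [e f]; rewrite /hcmul /= !mulrDl; congr pair.
  by rewrite opprD addrACA.
by rewrite addrACA.
Qed.

Lemma hcmulDr : right_distributive (@hcmul R) +%R.
Proof.
move=> [a b] [c d] [e f]; rewrite /hcmul /= !mulrDr; congr pair.
  by rewrite opprD addrACA.
by rewrite addrACA.
Qed.

Lemma hcone_neq0 : (1, 0) != 0 :> hc R.
Proof. by apply/eqP => -[] /eqP; rewrite oner_eq0. Qed.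

HB.instance Definition _ := GRing.Zmodule_isNzRing.Build (hc R)
  hcmulA hcmul1x hcmulx1 hcmulDl hcmulDr hcone_neq0.

Lemma hcscaleE (k : R) x : k *: x = (k *: x.1, k *: x.2).
Proof. by []. Qed.

Lemma hcscalerAl (k : R) x y : k *: hcmul x y = hcmul (k *: x) y.
Proof.
rewrite /hcmul !hcscaleE /=.
by rewrite scalerBr scalerDr -!scalerAl.
Qed.

HB.instance Definition _ :=
  GRing.Lmodule_isLalgebra.Build R (hc R) hcscalerAl.

Lemma hcscalerAr (k : R) x y : k *: hcmul x y = hcmul x (k *: y).
Proof.
rewrite /hcmul !hcscaleE /=.
by rewrite scalerBr scalerDr -!scalerAr.
Qed.

HB.instance Definition _ :=
  GRing.Lalgebra_isAlgebra.Build R (hc R) hcscalerAr.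

Lemma hcmulE x y : x * y = (x.1 * y.1 - x.2 * y.2, x.1 * y.2 + x.2 * y.1).
Proof. by []. Qed.

Lemma quat_norm_le (q : quat R) M :
  (`|q| <= M) =
  [&& `|q.1.1.1| <= M, `|q.1.1.2| <= M, `|q.1.2| <= M & `|q.2| <= M].
Proof. by rewrite !prod_normE !ge_max !andbA. Qed.

Lemma norm_sum4_le (m n : R) (x1 x2 x3 x4 y1 y2 y3 y4 : R) :
    `|x1| <= m -> `|x2| <= m -> `|x3| <= m -> `|x4| <= m ->
    `|y1| <= n -> `|y2| <= n -> `|y3| <= n -> `|y4| <= n ->
  `|x1 * y1 + x2 * y2 + x3 * y3 + x4 * y4| <= 4 * (m * n).
Proof.
have t (x y : R) : `|x| <= m -> `|y| <= n -> `|x * y| <= m * n.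
  by move=> *; rewrite normrM ler_pM.
move=> /t t1 /t t2 /t t3 /t t4 /t1 {}t1 /t2 {}t2 /t3 {}t3 /t4 {}t4.
have := ler_normD (x1 * y1 + x2 * y2 + x3 * y3) (x4 * y4).
have := ler_normD (x1 * y1 + x2 * y2) (x3 * y3).
by have := ler_normD (x1 * y1) (x2 * y2); lra.
Qed.

(** Each coordinate of a quaternion product is a sum of four products of
    coordinates; the sup norm is not submultiplicative. *)
Lemma ler_norm_quatM (p q : quat R) : `|p * q| <= 4 * (`|p| * `|q|).
Proof.
have bd m n : `|p| <= m -> `|q| <= n -> `|p * q| <= 4 * (m * n).
  rewrite !quat_norm_le => /and4P[p1 p2 p3 p4] /and4P[q1 q2 q3 q4].
  case: p q p1 p2 p3 p4 q1 q2 q3 q4 => [[[a b] c] d] [[[a' b'] c'] d'] /=.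
  move=> p1 p2 p3 p4 q1 q2 q3 q4; rewrite -!mulNr.
  by apply/and4P; split; apply: norm_sum4_le; rewrite ?normrN.
exact: bd (lexx `|p|) (lexx `|q|).
Qed.

Lemma hc_norm_le x M : (`|x| <= M) = (`|x.1| <= M) && (`|x.2| <= M).
Proof. by rewrite [`|x|]prod_normE ge_max. Qed.

Lemma ler_norm_hcM x y : `|x * y| <= 8 * (`|x| * `|y|).
Proof.
have /andP[x1 x2] : (`|x.1| <= `|x|) && (`|x.2| <= `|x|) by rewrite -hc_norm_le.
have /andP[y1 y2] : (`|y.1| <= `|y|) && (`|y.2| <= `|y|) by rewrite -hc_norm_le.
have bd (p q : quat R) : `|p| <= `|x| -> `|q| <= `|y| ->
    `|p * q| <= 4 * (`|x| * `|y|).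
  move=> px qy; apply: (le_trans (ler_norm_quatM _ _)).
  by apply: ler_wpM2l => //; apply: ler_pM.
have bd2 (p q : quat R) : `|p| <= 4 * (`|x| * `|y|) ->
    `|q| <= 4 * (`|x| * `|y|) -> `|p + q| <= 8 * (`|x| * `|y|).
  move=> pM qM; apply: (le_trans (ler_normD _ _)).
  have -> : 8 = 4 + 4 :> R by rewrite -natrD.
  by rewrite mulrDl lerD.
by rewrite hc_norm_le; apply/andP; split; apply: bd2; rewrite ?normrN bd.
Qed.

(** By [ler_norm_hcM], 8 times the norm is submultiplicative.  The estimate
    also holds for n = 0, as the norm of 1 is 1. *)
Lemma ler_norm_hcX x n : `|x ^+ n| <= (8 * `|x|) ^+ n.
Proof.
elim: n => [|n IHn].
  by rewrite !expr0 hc_norm_le normr0 quat_norm_le /= normr1 normr0 lexx ler01.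
rewrite !exprS (le_trans (ler_norm_hcM _ _))// mulrA.
by rewrite ler_wpM2l// mulr_ge0.
Qed.

End ComplexifiedQuaternions.

(** * Convergence in normed modules *)

Section BoundedMaps.
Variables (K : realType) (V W : normedModType K) (f : {linear V -> W}).

Lemma bounded_linear_cvg (M : K) (u : V^nat) (a : V) :
  (forall x, `|f x| <= M * `|x|) -> u @ \oo --> a -> f \o u @ \oo --> f a.
Proof.
move=> fM ua; have fc : continuous f.
  apply/linear_bounded_continuous/linear_boundedP; near=> r => x.
  by rewrite (le_trans (fM x))// ler_wpM2r//; near: r; exact: nbhs_pinfty_ge.
exact: (cvg_comp _ _ ua (fc a)).
Unshelve. all: by end_near. Qed.

End BoundedMaps.

Lemma norm_dominated_cvg0 (R : realType) (V : normedModType R) (u : V^nat)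
    (r : R^nat) :
  (forall n, `|u n| <= r n) -> r @ \oo --> 0 -> u @ \oo --> 0.
Proof.
move=> ur r0; apply: norm_cvg0.
apply: (@squeeze_cvgr _ _ _ _ (fun=> 0) r _ _ _ _ r0); last exact: cvg_cst.
by apply: nearW => n; rewrite normr_ge0 /=.
Qed.

(** * The exponential of the complexified quaternions *)

Section ExponentialTerms.
Variables (R : realType) (A : algType R).
Implicit Types x y : A.

Definition exp_term x : A^nat := fun n => (n`!%:R^-1 : R) *: x ^+ n.

Definition convolution (u v : A^nat) : A^nat :=
  fun n => \sum_(j < n.+1) u j * v (n - j)%N.

(** The binomial formula, divided by n!. *)
Lemma exp_termD x y : GRing.comm x y ->
  exp_term (x + y) = convolution (exp_term x) (exp_term y).
Proof.
move=> cxy; apply/funext => n; rewrite /exp_term /convolution.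
rewrite addrC exprDn_comm; last exact/commr_sym.
rewrite scaler_sumr; apply: eq_bigr => -[j /= jn] _; rewrite ltnS in jn.
rewrite -scalerAl -scalerAr scalerA.
rewrite (commrX _ (commr_sym (commrX _ cxy))) -(@scaler_nat R A) scalerA.
congr (_ *: _); rewrite -(bin_fact jn) !natrM invfM mulrC.
have j0 : j`!%:R != 0 :> R by rewrite pnatr_eq0 -lt0n fact_gt0.
have nj0 : (n - j)`!%:R != 0 :> R by rewrite pnatr_eq0 -lt0n fact_gt0.
have b0 : 'C(n, j)%:R != 0 :> R by rewrite pnatr_eq0 -lt0n bin_gt0.
by rewrite mulrA mulfV// mul1r invfM.
Qed.

(** The product of two n-th partial sums runs over the square j, k < n, the
    n-th partial sum of the Cauchy product over the triangle j + k < n. *)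
Lemma series_convolution (u v : A^nat) n :
  series u n * series v n - series (convolution u v) n =
  \sum_(0 <= j < n) \sum_(n - j <= k < n) u j * v k.
Proof.
have triangle m :
    series (convolution u v) m = \sum_(0 <= j < m) u j * series v (m - j)%N.
  elim: m => [|m IHm]; first by rewrite /series /= !big_geq.
  rewrite seriesSr IHm [RHS]big_nat_recr//= subSnn.
  rewrite /convolution big_ord_recr /= subnn.
  rewrite -(big_mkord xpredT (fun j => u j * v (m - j)%N)) addrA -big_split /=.
  congr (_ + _); last by rewrite seriesEnat /= big_nat1.
  apply: eq_big_nat => j /andP[_ jm].
  by rewrite subSn ?(ltnW jm)// seriesSr mulrDr.
rewrite triangle {1}/series /= mulr_suml -sumrB.
apply: eq_big_nat => j /andP[_ jn].
rewrite -mulrBr -mulr_sumr; congr (_ * _).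
by rewrite sub_series_geq ?leq_subr.
Qed.

End ExponentialTerms.

Section ExponentialSeries.
Variable R : realType.
Implicit Types x y : hc R.

Lemma cvgn_mul_hc (u v : (hc R)^nat) x y :
  u @ \oo --> x -> v @ \oo --> y -> (fun n => u n * v n) @ \oo --> x * y.
Proof.
move=> ux vy; apply/subr_cvg0.
have dx : `|u n - x| @[n --> \oo] --> 0 by apply/norm_cvg0P/subr_cvg0.
have dy : `|v n - y| @[n --> \oo] --> 0 by apply/norm_cvg0P/subr_cvg0.
apply: (@norm_dominated_cvg0 _ _ _
  (fun n => 8 * (`|u n - x| * `|v n|) + 8 * (`|x| * `|v n - y|))).
  move=> n; rewrite (_ : _ - _ = (u n - x) * v n + x * (v n - y)); last first.
    by rewrite mulrBl mulrBr addrA subrK.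
  by rewrite (le_trans (ler_normD _ _))// lerD// ler_norm_hcM.
rewrite (_ : 0 = 8 * (0 * `|y|) + 8 * (`|x| * 0) :> R); last first.
  by rewrite mul0r !mulr0 addr0.
by apply: cvgD; apply: cvgMr; apply: cvgM => //;
  [exact: cvg_norm|exact: cvg_cst].
Qed.

(** By [ler_norm_hcX], the n-th term is at most (8 |x|)^n / n!. *)
Lemma cvg_series_fact_bounded (a : R^nat) x :
  (forall n, `|a n| <= n`!%:R^-1) -> cvgn (series (fun n => a n *: x ^+ n)).
Proof.
move=> a_le; apply: normed_cvg.
apply: series_le_cvg (is_cvg_series_exp_coeff (8 * `|x|)) => n /=.
- exact: normr_ge0.
- by rewrite divr_ge0// exprn_ge0// mulr_ge0.
- rewrite normrZ mulrC ler_pM//; first exact: ler_norm_hcX.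
Qed.

Lemma cvg_exp_series x : cvgn (series (exp_term x)).
Proof. by apply: cvg_series_fact_bounded => n; rewrite ger0_norm. Qed.

Definition hcexp x : hc R := limn (series (exp_term x)).

(** The partial sums of exp x * exp y and of exp (x + y) differ by the terms
    x^j y^k / (j! k!) with j, k < n <= j + k.  These are bounded, up to the
    factor 8 of [ler_norm_hcM], by the same terms for the real numbers
    a = 8 |x| and b = 8 |y|, and the sum of the latter tends to
    e^a e^b - e^(a + b) = 0. *)
Lemma hcexpD x y : GRing.comm x y -> hcexp (x + y) = hcexp x * hcexp y.
Proof.
move=> cxy; apply/esym/eqP; rewrite -subr_eq0; apply/eqP.
pose a := 8 * `|x|; pose b := 8 * `|y|.
have ge0 (z : hc R) n : 0 <= exp_coeff (8 * `|z|) n.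
  by rewrite divr_ge0// exprn_ge0// mulr_ge0.
have leZ (z : hc R) n : `|exp_term z n| <= exp_coeff (8 * `|z|) n.
  rewrite normrZ mulrC ger0_norm ?invr_ge0// ler_wpM2r ?invr_ge0//.
  exact: ler_norm_hcX.
pose e n := series (exp_term x) n * series (exp_term y) n
            - series (exp_term (x + y)) n.
pose r n := series (exp_coeff a) n * series (exp_coeff b) n
            - series (exp_coeff (a + b)) n.
have e_lim : e @ \oo --> hcexp x * hcexp y - hcexp (x + y).
  apply: cvgB; last exact: cvg_exp_series.
  by apply: cvgn_mul_hc; exact: cvg_exp_series.
suff : e @ \oo --> 0 by move/(cvg_unique _ e_lim); apply.
have r_lim : r @ \oo --> 0.
  rewrite -(subrr (expR (a + b))) {1}expRD.
  by apply: cvgB; [apply: cvgM|]; exact: is_cvg_series_exp_coeff.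
have coeffE (z : R) : exp_coeff z = @exp_term _ R^o z.
  by apply/funext => n; rewrite /exp_coeff /exp_term /= mulrC.
have rE n : r n = \sum_(0 <= j < n) \sum_(n - j <= k < n)
    exp_coeff a j * exp_coeff b k.
  rewrite /r !coeffE exp_termD; last exact: mulrC.
  exact: (@series_convolution _ R^o).
apply: (@norm_dominated_cvg0 _ _ _ (fun n => 8 * r n)); last first.
  by rewrite -(mulr0 8); apply: cvgMr.
move=> n; rewrite rE /e exp_termD// series_convolution.
rewrite mulr_sumr (le_trans (ler_norm_sum _ _ _))// ler_sum// => j _.
rewrite mulr_sumr (le_trans (ler_norm_sum _ _ _))// ler_sum// => k _.
by rewrite (le_trans (ler_norm_hcM _ _))// ler_wpM2l// ler_pM.
Qed.

Definition cos_sqrt_coeff (m : nat) : R := (-1) ^+ m / (2 * m)`!%:R.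

Definition sinc_sqrt_coeff (m : nat) : R := (-1) ^+ m / (2 * m).+1`!%:R.

(** With k = 2 m and k = 2 m + 1, this brings both coefficient sequences within
    reach of [cvg_series_fact_bounded]. *)
Lemma sign_fact_le m k : (m <= k)%N -> `|(-1) ^+ m / k`!%:R : R| <= m`!%:R^-1.
Proof.
move=> mk; rewrite normrM normrX normrN1 expr1n mul1r ger0_norm ?invr_ge0//.
by rewrite lef_pV2 ?posrE ?ltr0n ?fact_gt0// ler_nat leq_fact.
Qed.

Lemma cvg_cos_sqrt x : cvgn (series (fun m => cos_sqrt_coeff m *: x ^+ m)).
Proof.
by apply: cvg_series_fact_bounded => m; rewrite sign_fact_le ?leq_pmull.
Qed.

Lemma cvg_sinc_sqrt x : cvgn (series (fun m => sinc_sqrt_coeff m *: x ^+ m)).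
Proof.
by apply: cvg_series_fact_bounded => m; rewrite sign_fact_le// leqW ?leq_pmull.
Qed.

Definition hccos_sqrt x : hc R :=
  limn (series (fun m => cos_sqrt_coeff m *: x ^+ m)).

Definition hcsinc_sqrt x : hc R :=
  limn (series (fun m => sinc_sqrt_coeff m *: x ^+ m)).

(** With s = - x ^ 2, the signs cancel: (-1)^m s^m = x ^ (2 m). *)
Lemma hcexp_even_odd x :
  hcexp x = hccos_sqrt (- x ^+ 2) + hcsinc_sqrt (- x ^+ 2) * x.
Proof.
pose s := - x ^+ 2.
have cC := @cvg_cos_sqrt s; have cD := @cvg_sinc_sqrt s.
set c := series _ in cC; set d := series _ in cD.
have termE m (k : R) : ((-1) ^+ m / k) *: s ^+ m = k^-1 *: x ^+ (2 * m).
  rewrite (_ : s = (-1 : R) *: x ^+ 2); last by rewrite scaleN1r.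
  by rewrite exprZn scalerA mulrAC -expr2 sqrr_sign mul1r -exprM.
have splitE m : series (exp_term x) (2 * m)%N = c m + d m * x.
  elim: m => [|m IHm]; first by rewrite /c /d /series /= !big_geq// mul0r addr0.
  rewrite mulnS !seriesSr IHm /exp_term /c /d !seriesSr
    /cos_sqrt_coeff /sinc_sqrt_coeff !termE mulrDl.
  by rewrite -scalerAl -exprSr addrACA addrA.
(* The even-indexed partial sums group the terms in pairs. *)
have lim1 : (fun m => series (exp_term x) (2 * m)%N) @ \oo --> hcexp x.
  apply: (cvg_comp _ _ (@cvg_mulnl 2 isT)); exact: cvg_exp_series.
have lim2 : (fun m => series (exp_term x) (2 * m)%N) @ \oo -->
    limn c + limn d * x.
  under eq_fun do rewrite splitE.
  have dx : (fun m => d m * x) @ \oo --> limn d * x.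
    by apply: (cvgn_mul_hc cD); exact: cvg_cst.
  exact: (cvgD cC dx).
exact: cvg_unique lim1 lim2.
Qed.

End ExponentialSeries.

(** * Conjugation and evaluation at an imaginary unit *)

Section QuaternionConjugation.
Variable R : realType.
Implicit Types (p q I : quat R) (x y : hc R).

Lemma qconj_is_linear : linear (@qconj R).
Proof.
move=> k [[[a b] c] d] [[[a' b'] c'] d'].
by congr (_, _, _, _); rewrite /= ?opprD ?scalerN.
Qed.

HB.instance Definition _ := GRing.isLinear.Build R (quat R) (quat R) _
  (@qconj R) qconj_is_linear.

Lemma qconjM p q : qconj (p * q) = qconj q * qconj p.
Proof.
case: p q => [[[a b] c] d] [[[a' b'] c'] d'].
by congr (_, _, _, _); rewrite /=; ring.
Qed.

Lemma qconj_involutive : involutive (@qconj R).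
Proof. by move=> [[[a b] c] d]; rewrite /= !opprK. Qed.

Lemma qconj_norm q : `|qconj q| = `|q|.
Proof.
apply/eqP; rewrite eq_le; case: q => [[[a b] c] d].
have h M : (`|(a, - b, - c, - d) : quat R| <= M) =
    (`|(a, b, c, d) : quat R| <= M).
  by rewrite !quat_norm_le /= !normrN.
by rewrite h lexx -h lexx.
Qed.

(** A quaternion fixed by the conjugation is real. *)
Lemma qconj_fixed_comm p q : qconj p = p -> p * q = q * p.
Proof.
case: p q => [[[a b] c] d] [[[a' b'] c'] d'] [hb hc hd].
have z0 (t : R) : - t = t -> t = 0 by move=> ?; lra.
rewrite (z0 b)// (z0 c)// (z0 d)//.
by congr (_, _, _, _); rewrite /=; ring.
Qed.

Local Arguments qconj {R} q : simpl never.

Lemma hcconj_is_linear : linear (@hcconj R).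
Proof.
move=> k x y; exact: congr2 (linearP (@qconj R) k x.1 y.1)
                            (linearP (@qconj R) k x.2 y.2).
Qed.

HB.instance Definition _ := GRing.isLinear.Build R (hc R) (hc R) _
  (@hcconj R) hcconj_is_linear.

Lemma hcconjM x y : hcconj (x * y) = hcconj y * hcconj x.
Proof.
rewrite /hcconj !hcmulE /= !(raddfB, raddfD) /= !qconjM.
by rewrite [X in (_, X)]addrC.
Qed.

Lemma hcconjK : involutive (@hcconj R).
Proof. by case=> a b; rewrite /hcconj /= !qconj_involutive. Qed.

Lemma hcconj1 : hcconj (1 : hc R) = 1.
Proof. by rewrite /hcconj /qconj /= !oppr0. Qed.

Lemma hcconjX x n : hcconj (x ^+ n) = hcconj x ^+ n.
Proof.
elim: n => [|n IHn]; first by rewrite !expr0 hcconj1.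
by rewrite exprS exprSr hcconjM IHn.
Qed.

Lemma hcconj_norm x : `|hcconj x| = `|x|.
Proof.
have h M : (`|hcconj x| <= M) = (`|x| <= M) by rewrite !hc_norm_le !qconj_norm.
by apply/eqP; rewrite eq_le h lexx -h lexx.
Qed.

Lemma hcconj_fixed_comm x y : hcconj x = x -> x * y = y * x.
Proof.
case: x y => [a b] [c d] [ha hb]; rewrite !hcmulE /=.
by rewrite !(qconj_fixed_comm _ ha) !(qconj_fixed_comm _ hb) [X in (_, X)]addrC.
Qed.

(** The elements fixed by the conjugation form a closed subalgebra. *)
Lemma hcconj_fixed_series (a : R^nat) x : hcconj x = x ->
  cvgn (series (fun n => a n *: x ^+ n)) ->
  hcconj (limn (series (fun n => a n *: x ^+ n))) =
  limn (series (fun n => a n *: x ^+ n)).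
Proof.
move=> hx; set u := series _ => cu.
have cc : @hcconj R \o u @ \oo --> hcconj (limn u).
  by apply: (bounded_linear_cvg (M := 1)) cu => y; rewrite hcconj_norm mul1r.
have uE : @hcconj R \o u = u.
  apply/funext => n; rewrite /u /series /= linear_sum.
  by apply: eq_bigr => k _; rewrite linearZ /= hcconjX hx.
by rewrite uE in cc; exact: cvg_unique cc cu.
Qed.

(** The linear map that recovers the value of a slice function at
    alpha + beta I from the value of its stem function at alpha + i beta. *)
Definition slice_eval I x : quat R := x.1 + I * x.2.

Lemma slice_eval_is_linear I : linear (slice_eval I).
Proof.
move=> k x y; rewrite /slice_eval /= mulrDr scalerDr -scalerAr.
by rewrite addrACA.
Qed.

HB.instance Definition _ I := GRing.isLinear.Build R (hc R) (quat R) _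
  (slice_eval I) (slice_eval_is_linear I).

Lemma slice_eval1 I : slice_eval I 1 = 1.
Proof. by rewrite /slice_eval /= mulr0 addr0. Qed.

(** The components of x are real, so they commute with I and I can be moved
    to the left of them; for general x the identity fails. *)
Lemma slice_evalM I x y : imag_units I -> hcconj x = x ->
  slice_eval I (x * y) = slice_eval I x * slice_eval I y.
Proof.
rewrite /imag_units /= => I2; case: x y => [a b] [c d] [ha hb].
rewrite /slice_eval hcmulE /= !mulrDl !mulrDr !mulrA -!(qconj_fixed_comm _ ha).
rewrite -(mulrA I b I) (qconj_fixed_comm I hb) mulrA -expr2 I2 mulN1r mulNr.
by rewrite -!addrA; congr (_ + _); rewrite addrC -addrA.
Qed.

Lemma slice_evalX I x n : imag_units I -> hcconj x = x ->
  slice_eval I (x ^+ n) = slice_eval I x ^+ n.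
Proof.
move=> hI hx; elim: n => [|n IHn]; first by rewrite !expr0 slice_eval1.
by rewrite !exprS slice_evalM// IHn.
Qed.

Lemma slice_eval_series I (u : (hc R)^nat) : cvgn (series u) ->
  series (slice_eval I \o u) @ \oo --> slice_eval I (limn (series u)).
Proof.
move=> cu.
have <- : slice_eval I \o series u = series (slice_eval I \o u).
  by apply/funext => n; rewrite /series /= linear_sum.
apply: (bounded_linear_cvg (M := 1 + 4 * `|I|)) cu => x.
have /andP[x1 x2] : (`|x.1| <= `|x|) && (`|x.2| <= `|x|) by rewrite -hc_norm_le.
rewrite mulrDl mul1r -mulrA; apply: (le_trans (ler_normD _ _)).
apply: (lerD x1); apply: (le_trans (ler_norm_quatM _ _)).
by apply: ler_wpM2l => //; apply: ler_wpM2l.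
Qed.

End QuaternionConjugation.

(** * Stem functions and the star product *)

Section Stems.
Variables (R : realType) (D : set (Cplane R)).
Hypothesis D_conj : conj_invariant D.
Implicit Types (f g : quat R -> quat R) (F G : Cplane R -> hc R).

Definition is_stem F f := stem_function D F /\ induces D F f.

Lemma is_stemE F f z : is_stem F f -> D z -> stem D f z = F z.
Proof.
move=> Ff Dz; have [_ h] : is_stem (stem D f) f.
  by rewrite /stem; case: xgetP => [_ _ //|/(_ F)]; case.
by case: Ff => _ /(induces_inj h); apply.
Qed.

(** In this form, F may be the expected stem function and G the expression
    built from the chosen stem functions [stem D f], which are determined on D
    only. *)
Lemma is_stem_slice F G : stem_function D F -> (forall z, D z -> G z = F z) ->
  is_stem F (slice G).
Proof.
move=> hF GF; have hG : stem_function D G.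
  by move=> z Dz; rewrite !GF//; [exact: hF|exact: D_conj].
split=> // z I Dz hI; rewrite (slice_induces D_conj hG Dz hI).
by rewrite !GF.
Qed.

Lemma hcbarM (x y : hc R) : hcbar (x * y) = hcbar x * hcbar y.
Proof. by rewrite /hcbar !hcmulE /= !(mulrN, mulNr) opprK opprD. Qed.

Lemma is_stem_star F G f g : is_stem F f -> is_stem G g ->
  is_stem (fun z => F z * G z) (star D f g).
Proof.
move=> Ff Gg; apply: is_stem_slice => z Dz.
  by rewrite (proj1 Ff)// (proj1 Gg)// hcbarM.
by rewrite (is_stemE Ff)// (is_stemE Gg).
Qed.

Lemma is_stem_star_pow F f n : is_stem F f ->
  is_stem (fun z => F z ^+ n) (star_pow D f n).
Proof.
move=> Ff; elim: n => [|n IHn].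
  split=> [z _|z I _ _]; first by rewrite /hcbar /= oppr0.
  by rewrite /= mulr0 addr0.
by under eq_fun do rewrite exprS; exact: (is_stem_star Ff IHn).
Qed.

Lemma hcconj_bar (x : hc R) : hcconj (hcbar x) = hcbar (hcconj x).
Proof. by case: x => [p [[[a b] c] d]]. Qed.

Lemma is_stem_conj F f : is_stem F f ->
  is_stem (fun z => hcconj (F z)) (slice_conj D f).
Proof.
move=> Ff; apply: is_stem_slice => z Dz; last by rewrite (is_stemE Ff).
by rewrite (proj1 Ff)// hcconj_bar.
Qed.

Lemma is_stem_add F G f g : is_stem F f -> is_stem G g ->
  is_stem (fun z => F z + G z) (fun q => f q + g q).
Proof.
move=> [F1 F2] [G1 G2]; split=> [z Dz|z I Dz hI].
  by rewrite F1// G1// /hcbar /= opprD.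
by rewrite F2// G2// /= mulrDr addrACA.
Qed.

Lemma is_stem_scale (k : R) F f : is_stem F f ->
  is_stem (fun z => k *: F z) (fun q => k *: f q).
Proof.
move=> [F1 F2]; split=> [z Dz|z I Dz hI].
  by rewrite F1// /hcbar !hcscaleE /= scalerN.
by rewrite F2// /= scalerDr scalerAr.
Qed.

Lemma is_stem_re F f : is_stem F f ->
  is_stem (fun z => 2^-1 *: (F z + hcconj (F z))) (slice_re D f).
Proof.
by move=> Ff; apply/is_stem_scale/is_stem_add => //; exact: is_stem_conj.
Qed.

Lemma is_stem_vec F f : is_stem F f ->
  is_stem (fun z => 2^-1 *: (F z - hcconj (F z))) (slice_vec D f).
Proof.
move=> Ff; apply/is_stem_scale.
have := is_stem_add Ff (is_stem_scale (-1) (is_stem_conj Ff)).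
under eq_fun do rewrite scaleN1r.
by under [X in is_stem _ X]eq_fun do rewrite scaleN1r.
Qed.

(** The star powers of f are induced by the powers of F, so the series at a
    point is the image of the exponential series of F z. *)
Lemma exp_star_series_cvg F f z I : is_stem F f -> D z -> imag_units I ->
  exp_star_series D f (z.1%:A + z.2 *: I) @ \oo --> slice_eval I (hcexp (F z)).
Proof.
move=> Ff Dz hI; have := slice_eval_series (I := I) (@cvg_exp_series _ (F z)).
suff -> : exp_star_series D f (z.1%:A + z.2 *: I) =
    series (slice_eval I \o exp_term (F z)) by [].
rewrite /exp_star_series; congr series; apply/funext => n.
rewrite /= (proj2 (is_stem_star_pow n Ff))//.
exact: esym (linearZ_LR (slice_eval I) _ _).
Qed.

End Stems.

(** * The decomposition of the exponential *)

Section ExponentialDecomposition.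
Variable R : realType.
Implicit Types (x : hc R) (I : quat R).

Lemma power_series_eval (a : R^nat) I x : imag_units I -> hcconj x = x ->
  cvgn (series (fun m => a m *: x ^+ m)) ->
  series (fun m => a m *: slice_eval I x ^+ m) @ \oo -->
  slice_eval I (limn (series (fun m => a m *: x ^+ m))).
Proof.
move=> hI hx /(slice_eval_series (I := I)).
suff -> : slice_eval I \o (fun m => a m *: x ^+ m) =
    (fun m => a m *: slice_eval I x ^+ m) by [].
apply/funext => m; rewrite -slice_evalX//.
exact: (linearZ_LR (slice_eval I)).
Qed.

Definition hcre x : hc R := 2^-1 *: (x + hcconj x).

Definition hcvec x : hc R := 2^-1 *: (x - hcconj x).

Lemma hcre_fixed x : hcconj (hcre x) = hcre x.
Proof. by rewrite /hcre linearZ linearD /= hcconjK addrC. Qed.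

Lemma hcconj_vec x : hcconj (hcvec x) = - hcvec x.
Proof. by rewrite /hcvec linearZ linearB /= hcconjK -scalerN opprB. Qed.

Lemma hcre_vecD x : hcre x + hcvec x = x.
Proof.
rewrite /hcre /hcvec -scalerDr addrACA subrr addr0 -mulr2n.
rewrite -(@scaler_nat R (hc R)) scalerA.
by rewrite mulVf ?pnatr_eq0// scale1r.
Qed.

(** The part fixed by the conjugation is central, so the exponential of the
    sum is the product of the exponentials. *)
Lemma hcexp_re_vec x : let s := - hcvec x ^+ 2 in
  hcexp x = hcexp (hcre x) * (hccos_sqrt s + hcsinc_sqrt s * hcvec x).
Proof.
rewrite /= -hcexp_even_odd -hcexpD ?hcre_vecD//.
exact/hcconj_fixed_comm/hcre_fixed.
Qed.

End ExponentialDecomposition.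

Theorem proposition4p5 (R : realType) (D : set (Cplane R))
    (D_conj : conj_invariant D)
    (Omega_open : open (circularization D))
    (Omega_connected : connected (circularization D))
    (Omega_nonempty : circularization D !=set0)
    (f : quat R -> quat R) (f_regular : slice_regular D f)
    (q : quat R) (Omega_q : circularization D q) :
  let f0 := slice_re D f in
  let fv := slice_vec D f in
  let fvs := slice_norm D fv in
  [/\ cvgn (exp_star_series D f q),
      cvgn (exp_star_series D f0 q),
      cvgn (cos_sqrt_series (fvs q)),
      cvgn (sinc_sqrt_series (fvs q)) &
      exp_star D f q =
        exp_star D f0 q *
        (limn (cos_sqrt_series (fvs q)) +
         limn (sinc_sqrt_series (fvs q)) * fv q)].
Proof.
move=> f0 fv fvs.
have [F [F_stem _ F_induces]] := f_regular.
have [z [I [Dz hI ->]]] := Omega_q.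
set p := _ + _; pose x := F z; pose s := - hcvec x ^+ 2.
have Ff : is_stem D F f by [].
have F0 : is_stem D (fun w => hcre (F w)) f0 by exact: is_stem_re.
have Fv : is_stem D (fun w => hcvec (F w)) fv by exact: is_stem_vec.
have s_fixed : hcconj s = s.
  by rewrite /s linearN /= hcconjX hcconj_vec sqrrN.
have fvpE : fv p = slice_eval I (hcvec x) by rewrite /p (proj2 Fv).
(* The norm of f_v is - (F_v)^2, because the conjugation negates F_v. *)
have fvspE : fvs p = slice_eval I s.
  have [_ Fvs] := is_stem_star D_conj Fv (is_stem_conj D_conj Fv).
  have -> : fvs p = slice_eval I (hcvec x * hcconj (hcvec x)) := Fvs z I Dz hI.
  by rewrite hcconj_vec mulrN -expr2.
have exp_cvg := exp_star_series_cvg D_conj Ff Dz hI.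
have exp0_cvg := exp_star_series_cvg D_conj F0 Dz hI.
have cos_cvg : cos_sqrt_series (fvs p) @ \oo --> slice_eval I (hccos_sqrt s).
  rewrite fvspE.
  exact: (@power_series_eval _ (@cos_sqrt_coeff R) _ _ hI s_fixed
    (@cvg_cos_sqrt _ s)).
have sinc_cvg : sinc_sqrt_series (fvs p) @ \oo --> slice_eval I (hcsinc_sqrt s).
  rewrite fvspE.
  exact: (@power_series_eval _ (@sinc_sqrt_coeff R) _ _ hI s_fixed
    (@cvg_sinc_sqrt _ s)).
split; [exact: cvgP exp_cvg|exact: cvgP exp0_cvg|exact: cvgP cos_cvg|
        exact: cvgP sinc_cvg|].
have expE : exp_star D f p = slice_eval I (hcexp x).
  by apply: cvg_lim exp_cvg.
have exp0E : exp_star D f0 p = slice_eval I (hcexp (hcre x)).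
  by apply: cvg_lim exp0_cvg.
have cosE : limn (cos_sqrt_series (fvs p)) = slice_eval I (hccos_sqrt s).
  by apply: cvg_lim cos_cvg.
have sincE : limn (sinc_sqrt_series (fvs p)) = slice_eval I (hcsinc_sqrt s).
  by apply: cvg_lim sinc_cvg.
rewrite expE exp0E cosE sincE fvpE hcexp_re_vec.
have e0_fixed : hcconj (hcexp (hcre x)) = hcexp (hcre x).
  by apply: hcconj_fixed_series; [exact: hcre_fixed|exact: cvg_exp_series].
have S_fixed : hcconj (hcsinc_sqrt s) = hcsinc_sqrt s.
  by apply: hcconj_fixed_series => //; exact: cvg_sinc_sqrt.
have evalD : slice_eval I (hccos_sqrt s + hcsinc_sqrt s * hcvec x) =
    slice_eval I (hccos_sqrt s) +
    slice_eval I (hcsinc_sqrt s) * slice_eval I (hcvec x).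
  rewrite -(slice_evalM _ hI S_fixed).
  exact: (linearD (slice_eval I)).
by rewrite (slice_evalM _ hI e0_fixed) -evalD.
Qed.
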